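(* Let $G$ be a matrix Lie group and let $G \curvearrowright X$ be a free continuous action on a second-countable locally compact Hausdorff space $X$. Then $G\curvearrowright X$ admits slices: for every compact identity neighbourhood $K\subseteq G$ and every $x\in X$ there exists a $K$-slice $S\subseteq X$ such that $x\in\mathrm{int}_{\mathrm{tube}}(S)$.
   Context: A matrix Lie group is a closed subgroup of $\mathrm{GL}(n,\mathbb{R})$ for some $n\in\mathbb{N}$, with the subspace topology. Let $K\subseteq G$ be a compact identity neighbourhood. A $K$-slice is a compact subset $S\subseteq X$ such that the map $K\times S\to X$, $(g,x)\mapsto gx$, is injective. The tube interior of a $K$-slice $S$ is $\mathrm{int}_{\mathrm{tube}}(S)=S\cap(KS)^\circ$, where $(KS)^\circ$ is the interior of $KS$ in $X$ (this does not depend on the choice of $K$). *)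

(* Defs.v *)
From mathcomp Require Import all_boot all_order all_algebra.
From mathcomp Require Import all_classical all_reals all_analysis.
Import Order.TTheory GRing.Theory Num.Theory.
Import numFieldNormedType.Exports.

Set Implicit Arguments.
Unset Strict Implicit.
Unset Printing Implicit Defensive.

Local Open Scope classical_set_scope.
Local Open Scope ring_scope.

Definition GL (R : realType) (n : nat) : set 'M[R]_n := [set A | A \in unitmx].
Arguments GL : clear implicits.

(* Closedness is relative to GL(n, R), which is not closed in 'M[R]_n. *)
Record matrix_lie_group (R : realType) (n : nat) (G : set 'M[R]_n) : Prop := {
  mlg_sub : G `<=` GL R n;
  mlg_one : G 1%:M;
  mlg_mul : forall g h, G g -> G h -> G (g *m h);
  mlg_inv : forall g, G g -> G (invmx g);
  mlg_closed : closed (G : set (subspace (GL R n)))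
}.

(* An action of G is a map on all of 'M[R]_n whose values outside G are
   irrelevant; every condition below only involves its restriction to G. *)
Record continuous_action (R : realType) (n : nat) (G : set 'M[R]_n)
    (X : topologicalType) (act : 'M[R]_n -> X -> X) : Prop := {
  act_one : forall x, act 1%:M x = x;
  act_mul : forall g h x, G g -> G h -> act (g *m h) x = act g (act h x);
  act_continuous :
    {within G `*` [set: X], continuous (fun p : 'M[R]_n * X => act p.1 p.2)}
}.

Definition free_action (R : realType) (n : nat) (G : set 'M[R]_n)
    (X : topologicalType) (act : 'M[R]_n -> X -> X) : Prop :=
  forall g x, G g -> act g x = x -> g = 1%:M.

Definition compact_identity_nbhd (R : realType) (n : nat)
    (G K : set 'M[R]_n) : Prop :=
  [/\ K `<=` G, compact K & nbhs (1%:M : subspace G) K].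

Definition translates (R : realType) (n : nat) (X : topologicalType)
    (act : 'M[R]_n -> X -> X) (K : set 'M[R]_n) (S : set X) : set X :=
  [set act g x | g in K & x in S].

Definition slice (R : realType) (n : nat) (X : topologicalType)
    (act : 'M[R]_n -> X -> X) (K : set 'M[R]_n) (S : set X) : Prop :=
  compact S /\ set_inj (K `*` S) (fun p => act p.1 p.2).

Definition tube_interior (R : realType) (n : nat) (X : topologicalType)
    (act : 'M[R]_n -> X -> X) (K : set 'M[R]_n) (S : set X) : set X :=
  S `&` (translates act K S)°.

Definition admits_slices (R : realType) (n : nat) (G : set 'M[R]_n)
    (X : topologicalType) (act : 'M[R]_n -> X -> X) : Prop :=
  forall (K : set 'M[R]_n) (x : X), compact_identity_nbhd G K ->
    exists S : set X, slice act K S /\ tube_interior act K S x.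

(* Main.v *)
Require Import Defs.
From mathcomp Require Import all_boot all_order all_algebra.
From mathcomp Require Import all_classical all_reals all_analysis.
From mathcomp Require Import ring lra.
Import Order.TTheory GRing.Theory Num.Theory.
Import numFieldNormedType.Exports.

Set Implicit Arguments.
Unset Strict Implicit.
Unset Printing Implicit Defensive.

Local Open Scope classical_set_scope.
Local Open Scope ring_scope.

(* No Haar measure, exponential map or inverse function theorem is needed.
   Let T be the set of X such that 1 + tX is o(t)-close to G as t tends to 0+.
   It is a linear subspace, and h - 1 is o(|h - 1|)-close to T for h in G near 1.
   For a cut-off function f vanishing at x and large on the part of the orbit
   away from x (which exists since the action is free), the inf-convolution
     F(y)_ij = min over g in G near 1 of f(gy) - (g - 1)_ij
   is continuous and satisfies |F(hy) - F(y) - (h - 1)| <= e |h - 1| for h near 1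
   and y, hy near x.  With P a projection onto T and H(y) = P(F(y) - F(x)), the
   slice is the zero set of H in a small compact neighbourhood of x.  Orbits meet
   it at most once locally, since |H(hy) - H(y)| >= |h - 1| / 2; freeness and
   compactness extend this to K.  They do meet it, since a minimizer h of
   |H(hy)| with v = H(hy) <> 0 could be improved by an element of G close to
   1 - tv. *)

(** * Norm estimates for matrix products, inverses and powers *)

Section MatrixNorm.
Context {R : realType} {n : nat}.
Implicit Types A B : 'M[R]_n.

Lemma le_entry_norm A i j : `|A i j| <= `|A|.
Proof.
by rewrite [leRHS]/Num.Def.normr /= mx_normrE; apply/bigmax_geP;
  right; exists (i, j).
Qed.

Lemma norm_le_entries A e :
  0 <= e -> (forall i j, `|A i j| <= e) -> `|A| <= e.
Proof.
move=> e0 Ae; rewrite [leLHS]/Num.Def.normr /= mx_normrE.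
by apply: bigmax_le => // -[i j] _; exact: Ae.
Qed.

(** The entrywise sup norm is submultiplicative up to the factor [n]; the successor makes the
    constant at least 1, also for [n = 0]. *)
Definition mulmx_cst : R := n.+1%:R.

Lemma mulmx_cst_ge1 : 1 <= mulmx_cst. Proof. by rewrite ler1n. Qed.

Lemma mulmx_cst_gt0 : 0 < mulmx_cst. Proof. by rewrite ltr0n. Qed.

Lemma norm_mulmx A B : `|A *m B| <= mulmx_cst * `|A| * `|B|.
Proof.
apply: norm_le_entries => [|i j]; first by rewrite !mulr_ge0// ltW ?mulmx_cst_gt0.
rewrite mxE (le_trans (ler_norm_sum _ _ _))//.
apply: (@le_trans _ _ (\sum_(k < n) `|A| * `|B|)).
  by apply: ler_sum => k _; rewrite normrM ler_pM// le_entry_norm.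
rewrite sumr_const card_ord -mulr_natl -mulrA ler_wpM2r ?mulr_ge0//.
by rewrite ler_nat.
Qed.

Lemma norm_mx1 : `|1%:M : 'M[R]_n| <= 1.
Proof.
by apply: norm_le_entries => // i j; rewrite mxE; case: eqP; rewrite ?normr1 ?normr0.
Qed.

(** Since [A^-1 = 1 - A^-1 (A - 1)], the norm of the inverse is at most 1 plus half of itself. *)
Lemma norm_invmx A :
  A \in unitmx -> mulmx_cst * `|A - 1%:M| <= 1 / 2 -> `|invmx A| <= 2.
Proof.
move=> uA hA.
have E : invmx A = 1%:M - invmx A *m (A - 1%:M).
  by rewrite mulmxBr mulVmx// mulmx1 opprB addrC subrK.
have := norm_mx1; have := norm_mulmx (invmx A) (A - 1%:M).
have := ler_normB 1%:M (invmx A *m (A - 1%:M)); rewrite -E.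
have : `|invmx A| * (mulmx_cst * `|A - 1%:M|) <= `|invmx A| * (1 / 2).
  by rewrite ler_wpM2l.
rewrite mulrA [`|invmx A| * mulmx_cst]mulrC; lra.
Qed.

(** Induction on [m]: passing from [A^m] to [A^(m+1)] adds the error [(A - 1)(A^m - 1)], of norm at
    most [2 c m s^2] with [c = mulmx_cst], which is less than the growth of [c (m s)^2]. *)
Lemma norm_iter_mulmx A m (s := `|A - 1%:M|) : mulmx_cst * (m%:R * s) <= 1 ->
  `|iter m (mulmx A) 1%:M - 1%:M - m%:R *: (A - 1%:M)|
    <= mulmx_cst * (m%:R * s) ^+ 2.
Proof.
have c1 := mulmx_cst_ge1; have s0 : 0 <= s by exact: normr_ge0.
elim: m => [_|m IH hm] /=.
  by rewrite subrr scale0r subr0 normr0 mul0r expr0n/= mulr0.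
set B := iter m _ _ in IH *.
have m0 : 0 <= m%:R :> R by [].
rewrite -natr1 in hm *.
have hm' : mulmx_cst * (m%:R * s) <= 1.
  apply: le_trans hm; rewrite ler_pM2l ?mulmx_cst_gt0// ler_wpM2r//; lra.
have {}IH := IH hm'.
have -> : A *m B - 1%:M - (m%:R + 1) *: (A - 1%:M) =
    (B - 1%:M - m%:R *: (A - 1%:M)) + (A - 1%:M) *m (B - 1%:M).
  rewrite mulmxBr mulmx1 mulmxBl mul1mx scalerDl scale1r.
  move: (A *m B) => AB.
  by apply/matrixP => i j; rewrite !mxE; ring.
have B1 : `|B - 1%:M| <= 2 * (m%:R * s).
  have := ler_normD (B - 1%:M - m%:R *: (A - 1%:M)) (m%:R *: (A - 1%:M)).
  rewrite subrK normrZ ger0_norm// -/s.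
  have : mulmx_cst * (m%:R * s) ^+ 2 <= m%:R * s.
    have -> : mulmx_cst * (m%:R * s) ^+ 2 =
        (mulmx_cst * (m%:R * s)) * (m%:R * s) by ring.
    by apply: ler_piMl => //; rewrite mulr_ge0.
  lra.
apply: le_trans (ler_normD _ _) _.
have := norm_mulmx (A - 1%:M) (B - 1%:M); rewrite -/s.
have : mulmx_cst * s * `|B - 1%:M| <= mulmx_cst * s * (2 * (m%:R * s)).
  by rewrite ler_wpM2l// mulr_ge0//; lra.
have : mulmx_cst * ((m%:R + 1) * s) ^+ 2 =
  mulmx_cst * (m%:R * s) ^+ 2 + mulmx_cst * s * (2 * (m%:R * s)) +
  mulmx_cst * s ^+ 2 by ring.
have : 0 <= mulmx_cst * s ^+ 2 by rewrite mulr_ge0 ?sqr_ge0//; lra.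
lra.
Qed.

(** Heine-Borel for row vectors, carried over to matrices along the continuous [vec_mx]. *)
Lemma compact_unit_sphere_mx : compact [set A : 'M[R]_n | `|A| = 1].
Proof.
have -> : [set A : 'M[R]_n | `|A| = 1] =
    vec_mx @` [set v | `|vec_mx v : 'M[R]_n| = 1].
  apply/seteqP; split => [A A1|_ [v v1 <-]//].
  by exists (mxvec A); rewrite /= mxvecK.
have cv : continuous (vec_mx : 'rV[R]_(n * n) -> 'M[R]_n).
  move=> v U; rewrite -!nbhs_ballE => -[e e0 eU]; exists e => // w [_ vw].
  by apply: eU; split => // i j; rewrite !mxE; exact: vw.
apply: continuous_compact; first exact: continuous_subspaceT.
apply: bounded_closed_compact.
  exists 1; split => // M M1 v /= v1.
  rewrite [leLHS]/Num.Def.normr /= mx_normrE; apply: bigmax_le => [|[i j] _ /=].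
    by rewrite ltW// (lt_trans _ M1).
  case/mxvec_indexP: j => k l; rewrite (ord1 i) -[v]vec_mxK mxvecE.
  by rewrite (le_trans (le_entry_norm _ _ _))// v1 ltW.
have -> : [set v | `|vec_mx v : 'M[R]_n| = 1] =
    (fun v => `|vec_mx v : 'M[R]_n|) @^-1` [set 1] by [].
apply: preimage_closed => [v _|]; last exact: closed_eq.
by apply: continuous_comp; [exact: cv|exact: norm_continuous].
Qed.

End MatrixNorm.

(** * The tangent space of [G] at the identity *)

Section Tangent.
Context {R : realType} {n : nat} (G : set 'M[R]_n) (hG : matrix_lie_group G).
Implicit Types (h X Y u : 'M[R]_n) (e t : R).
Local Notation c := (@mulmx_cst R n).

(** Asking for every small [t], not just for a sequence tending to 0, lets two tangent vectors be
    realized at the same [t], which makes their sum tangent. *)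
Definition tangent : set 'M[R]_n := [set X | forall e, 0 < e ->
  exists2 d, 0 < d & forall t, 0 < t < d ->
  exists2 h, G h & `|h - 1%:M - t *: X| <= e * t].

Let small_mul (D e t : R) : 0 <= D -> 0 < t < e / (D + 1) -> t * D <= e.
Proof.
move=> D0 /andP[t0]; rewrite ltr_pdivlMr; last lra.
by nra.
Qed.

Let divp_gt0 (D e : R) : 0 <= D -> 0 < e -> 0 < e / (D + 1).
Proof. by move=> D0 e0; rewrite divr_gt0//; lra. Qed.

Let step_le h X e t : 0 < t -> `|h - 1%:M - t *: X| <= e * t ->
  `|h - 1%:M| <= t * (`|X| + e).
Proof.
move=> t0 hX; have := ler_normD (h - 1%:M - t *: X) (t *: X).
by rewrite subrK normrZ gtr0_norm//; lra.
Qed.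

(** If [h1] and [h2] realize [X] and [Y] at time [t], then [h1 h2] realizes [X + Y]: the cross term
    [(h1 - 1)(h2 - 1)] is at most [t^2 D]. *)
Lemma tangentD X Y : tangent X -> tangent Y -> tangent (X + Y).
Proof.
move=> TX TY e e0; have c1 := @mulmx_cst_ge1 R n.
have e40 : 0 < e / 4 by lra.
have [d1 d10 H1] := TX _ e40; have [d2 d20 H2] := TY _ e40.
set D := c * (`|X| + e / 4) * (`|Y| + e / 4).
have X0 := normr_ge0 X; have Y0 := normr_ge0 Y.
have D0 : 0 <= D by rewrite !mulr_ge0//; lra.
exists (Num.min d1 (Num.min d2 (e / 4 / (D + 1)))).
  by rewrite !lt_min d10 d20 divp_gt0.
move=> t; rewrite !lt_min => /andP[t0 /and3P[td1 td2 tD]].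
have [|h1 G1 h1X] := H1 t; first by rewrite t0.
have [|h2 G2 h2Y] := H2 t; first by rewrite t0.
exists (h1 *m h2); first exact: mlg_mul.
have -> : h1 *m h2 - 1%:M - t *: (X + Y) = (h1 - 1%:M - t *: X) +
    (h2 - 1%:M - t *: Y) + (h1 - 1%:M) *m (h2 - 1%:M).
  rewrite mulmxBr mulmx1 mulmxBl mul1mx; move: (h1 *m h2) => H.
  by apply/matrixP => i j; rewrite !mxE; ring.
have := norm_mulmx (h1 - 1%:M) (h2 - 1%:M).
have : c * `|h1 - 1%:M| * `|h2 - 1%:M| <=
    c * (t * (`|X| + e / 4)) * (t * (`|Y| + e / 4)).
  have := step_le t0 h1X; have := step_le t0 h2Y => ? ?.
  by rewrite !ler_pM// ?mulr_ge0//; lra.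
have -> : c * (t * (`|X| + e / 4)) * (t * (`|Y| + e / 4)) = t * (t * D).
  by rewrite /D; ring.
have : t * (t * D) <= t * (e / 4).
  by rewrite ler_pM2l// small_mul// t0.
have := ler_normD (h1 - 1%:M - t *: X + (h2 - 1%:M - t *: Y))
  ((h1 - 1%:M) *m (h2 - 1%:M)).
have := ler_normD (h1 - 1%:M - t *: X) (h2 - 1%:M - t *: Y).
have : 0 < e * t by rewrite mulr_gt0.
lra.
Qed.

Lemma tangent0 : tangent 0.
Proof.
move=> e e0; exists 1 => // t /andP[t0 _]; exists 1%:M; first exact: mlg_one.
by rewrite subrr scaler0 subr0 normr0 mulr_ge0// ltW.
Qed.

(** If [h] realizes [X], then [h^-1] realizes [- X], because [h^-1 - 1 + t X] equals [h^-1] times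
    [- (h - 1 - t X) + t (h - 1) X], whose second term is quadratic in [t]. *)
Lemma tangentN X : tangent X -> tangent (- X).
Proof.
move=> TX e e0; have c1 := @mulmx_cst_ge1 R n; have X0 := normr_ge0 X.
set e1 := e / (4 * c).
have e10 : 0 < e1 by rewrite divr_gt0//; lra.
have [d d0 H] := TX _ e10.
(* [D1] forces [c |h - 1| <= 1 / 2], so that [h^-1] has norm at most 2; [D2] controls the quadratic
   term. *)
set D1 := 2 * c * (`|X| + e1); set D2 := 4 * c * c * (`|X| + e1) * `|X|.
have D10 : 0 <= D1 by rewrite !mulr_ge0//; lra.
have D20 : 0 <= D2 by rewrite !mulr_ge0//; lra.
exists (Num.min d (Num.min (1 / (D1 + 1)) (e / (D2 + 1)))).
  by rewrite !lt_min d0 !divp_gt0.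
move=> t; rewrite !lt_min => /andP[t0 /and3P[td tD1 tD2]].
have [|h Gh hX] := H t; first by rewrite t0.
have {tD1}tD1 : t * D1 <= 1 by rewrite small_mul// t0.
have {tD2}tD2 : t * D2 <= e by rewrite small_mul// t0.
have uh : h \in unitmx by exact: (mlg_sub hG).
have h1 := step_le t0 hX.
have ch1 : c * `|h - 1%:M| <= 1 / 2.
  apply: (@le_trans _ _ (c * (t * (`|X| + e1)))); first by rewrite ler_pM2l//; lra.
  have -> : c * (t * (`|X| + e1)) = t * D1 / 2 by rewrite /D1; field.
  lra.
have hV := norm_invmx uh ch1.
exists (invmx h); first exact: mlg_inv.
have -> : invmx h - 1%:M - t *: - X =
    invmx h *m (- (h - 1%:M - t *: X) + t *: ((h - 1%:M) *m X)).
  rewrite mulmxBl mul1mx scalerBr.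
  have -> : - (h - 1%:M - t *: X) + (t *: (h *m X) - t *: X) =
      1%:M - h + t *: (h *m X).
    by move: (h *m X) => Z; apply/matrixP => i j; rewrite !mxE; ring.
  rewrite mulmxDr mulmxBr mulmx1 mulVmx// -scalemxAr mulmxA mulVmx// mul1mx.
  by rewrite scalerN opprK.
apply: le_trans (norm_mulmx _ _) _.
set Z := _ + t *: _.
have hZ : `|Z| <= e1 * t + t * (c * (t * (`|X| + e1)) * `|X|).
  apply: le_trans (ler_normD _ _) _; rewrite normrN lerD// normrZ gtr0_norm//.
  rewrite ler_pM2l//; apply: le_trans (norm_mulmx _ _) _.
  by rewrite ler_wpM2r// ler_pM2l//; lra.
apply: (@le_trans _ _ (c * 2 *
    (e1 * t + t * (c * (t * (`|X| + e1)) * `|X|)))).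
  by apply: ler_pM => //; [rewrite mulr_ge0//; lra|rewrite ler_pM2l//; lra].
have -> : c * 2 * (e1 * t + t * (c * (t * (`|X| + e1)) * `|X|)) =
   2 * c * e1 * t + t * (t * D2) / 2.
  by rewrite /D2; field.
have -> : 2 * c * e1 * t = e * t / 2 by rewrite /e1; field; lra.
have : t * (t * D2) <= t * e by rewrite ler_pM2l.
lra.
Qed.

Lemma tangentZ a X : tangent X -> tangent (a *: X).
Proof.
have pos b Y : 0 < b -> tangent Y -> tangent (b *: Y).
  move=> b0 TY e e0; have [|d d0 H] := TY (e / b); first by rewrite divr_gt0.
  exists (d / b); first by rewrite divr_gt0.
  move=> t /andP[t0]; rewrite ltr_pdivlMr// => tbd.
  have [|h Gh hY] := H (t * b); first by rewrite mulr_gt0.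
  exists h => //; rewrite scalerA (le_trans hY)//.
  by rewrite [t * b]mulrC mulrA divfK// gt_eqF.
move=> TX; have [a0|a0|<-] := ltgtP 0 a; first exact: pos.
  rewrite -[a]opprK scaleNr -scalerN; apply: pos; first lra.
  exact: tangentN.
by rewrite scale0r; exact: tangent0.
Qed.

Lemma mlg_iter h m : G h -> G (iter m (mulmx h) 1%:M).
Proof.
by move=> Gh; elim: m => [|m IH] /=; [exact: mlg_one|exact: mlg_mul].
Qed.

(* The powers of group elements approaching [1] in the direction [u] come
   [o(t)]-close to [1 + t u] for every small [t], not just along a sequence. *)
Lemma tangent_limit u :
  (forall e d, 0 < e -> 0 < d -> exists h, [/\ G h, 0 < `|h - 1%:M| <= d &
     `|h - 1%:M - `|h - 1%:M| *: u| <= e * `|h - 1%:M|]) -> tangent u.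
Proof.
move=> H e e0; have c1 := @mulmx_cst_ge1 R n; have U0 := normr_ge0 u.
have c0 : 0 < c by lra.
exists (Num.min (1 / c) (e / 4 / c)); first by rewrite lt_min !divr_gt0//; lra.
move=> t; rewrite lt_min !ltr_pdivlMr// => /andP[t0 /andP[tc1 tce]].
have [||h [Gh /andP[s0 sd] hu]] := H (e / 4) (e / 4 * t / (`|u| + 1)).
- lra.
- by apply: divp_gt0 => //; rewrite mulr_gt0//; lra.
move: sd hu; set s := `|h - 1%:M| in s0 * => sd hu.
have su : s * `|u| <= e / 4 * t.
  by move: sd; rewrite ler_pdivlMr; [nra|lra].
(* With this exponent [m s] lies within [s] of [t], and [h^m - 1] is close in turn to [m (h - 1)],
   [m s u] and [t u]. *)
set m := Num.truncn (t / s).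
have /andP[] := @truncn_itv _ (t / s) (divr_ge0 (ltW t0) (ltW s0)).
rewrite -/m ler_pdivlMr// ltr_pdivrMr// -natr1 => ms1 ms2.
have m0 : 0 <= m%:R :> R by [].
have ms0 : 0 <= m%:R * s by rewrite mulr_ge0// ltW.
exists (iter m (mulmx h) 1%:M); first exact: mlg_iter.
have hms : c * (m%:R * s) <= 1.
  by apply: le_trans (_ : c * t <= 1); [rewrite ler_pM2l|lra].
have E1 := norm_iter_mulmx hms; rewrite -/s in E1.
set B := iter _ _ _ in E1 *.
have -> : B - 1%:M - t *: u = (B - 1%:M - m%:R *: (h - 1%:M)) +
    m%:R *: (h - 1%:M - s *: u) + (m%:R * s - t) *: u.
  by apply/matrixP => i j; rewrite !mxE; ring.
have : `|(m%:R * s - t) *: u| <= e / 4 * t.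
  rewrite normrZ; apply: le_trans su; rewrite ler_wpM2r//.
  by rewrite ler_norml; lra.
have : `|m%:R *: (h - 1%:M - s *: u)| <= e / 4 * t.
  rewrite normrZ ger0_norm//; apply: (@le_trans _ _ (m%:R * (e / 4 * s))).
    by rewrite ler_wpM2l.
  by rewrite mulrCA ler_pM2l//; lra.
have : c * (m%:R * s) ^+ 2 <= e / 4 * t.
  apply: (@le_trans _ _ (c * t ^+ 2)).
    by rewrite ler_pM2l// ler_pXn2r// nnegrE ltW.
  by rewrite expr2 mulrA ler_pM2r//; lra.
have := ler_normD (B - 1%:M - m%:R *: (h - 1%:M) + m%:R *: (h - 1%:M - s *: u))
  ((m%:R * s - t) *: u).
have := ler_normD (B - 1%:M - m%:R *: (h - 1%:M)) (m%:R *: (h - 1%:M - s *: u)).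
have : 0 < e * t by rewrite mulr_gt0.
lra.
Qed.

(** Compactness of the sphere of directions. If [u] is tangent, [|h - 1| u] approximates [h - 1] for
    all [h] with direction near [u]; if not, [tangent_limit] shows that no [h] in [G] close to 1 has
    a direction near [u]. *)
Lemma near_tangent e : 0 < e -> exists2 d, 0 < d &
  forall h, G h -> `|h - 1%:M| <= d ->
  exists2 X, tangent X & `|h - 1%:M - X| <= e * `|h - 1%:M|.
Proof.
move=> e0.
pose P (d : R) u := forall h, G h -> 0 < `|h - 1%:M| <= d ->
  h - 1%:M = `|h - 1%:M| *: u ->
  exists2 X, tangent X & `|h - 1%:M - X| <= e * `|h - 1%:M|.
have : \forall d \near 0^'+, [set u : 'M[R]_n | `|u| = 1] `<=` P d.
  apply: (compact_near_coveringP _).1 (@compact_unit_sphere_mx R n) _ _ _ _ _ => u _.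
  have nbu : forall r : R, 0 < r -> \forall v \near u, `|v - u| <= r.
    move=> r r0; apply: filterS (nbhsx_ballx u r r0) => v.
    by rewrite -ball_normE /= distrC => /ltW.
  have [Tu|/(contra_not (@tangent_limit u))] := pselect (tangent u).
    near=> v d => h Gh _ hv.
    exists (`|h - 1%:M| *: u); first exact: tangentZ.
    rewrite {1}hv -scalerBr normrZ normr_id mulrC ler_wpM2r//.
    exact: (near (nbu e e0) v).
  move=> /existsNP[r /existsNP[d0 /not_implyP[r0 /not_implyP[d00 nH]]]].
  near=> v d => h Gh /andP[h0 hd] hv; exfalso; apply: nH; exists h; split => //.
    rewrite h0 (le_trans hd)//.
    exact: (near (nbhs_right_le d00) d).
  rewrite {1}hv -scalerBr normrZ normr_id mulrC ler_wpM2r//.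
  exact: (near (nbu r r0) v).
move=> /(filterI (nbhs_right_gt 0)) /filter_ex [d [d0 Hd]].
exists d => // h Gh hd; have [h0|h0] := eqVneq `|h - 1%:M| 0.
  exists 0; first exact: tangent0.
  by rewrite subr0 h0 mulr0.
apply: (Hd (`|h - 1%:M|^-1 *: (h - 1%:M))) => //.
- by rewrite /= normrZ normfV normr_id mulVf.
- by rewrite lt_def h0 normr_ge0.
- by rewrite scalerA divff// scale1r.
Unshelve. all: by end_near. Qed.

End Tangent.

(** * Linear projection onto the tangent space *)

Lemma vspace_of_set (K : fieldType) (V : vectType K) (T : set V) :
  T 0 -> (forall u v, T u -> T v -> T (u + v)) ->
  (forall a u, T u -> T (a *: u)) ->
  exists U : {vspace V}, forall u, T u <-> u \in U.
Proof.
move=> T0 TD TZ.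
(* A subspace of maximal dimension inside [T] exhausts [T], since a further vector of [T] would span
   a larger one with it. *)
pose p k := `[< exists2 U : {vspace V}, (forall u, u \in U -> T u) & \dim U = k >].
have p0 : exists k, p k.
  exists 0%N; apply/asboolP; exists 0%VS; rewrite ?dimv0//.
  by move=> u /vlineP[a ->]; rewrite scaler0.
have pmax k : p k -> (k <= \dim {:V})%N.
  by move=> /asboolP[U _ <-]; rewrite dimvS// subvf.
case: (ex_maxnP p0 pmax) => k /asboolP[U UT Uk] kmax.
exists U => u; split; last exact: UT.
move=> Tu; apply: contrapT => /negP uU.
have /asboolP/kmax : exists2 W : {vspace V},
    (forall w, w \in W -> T w) & \dim W = \dim (U + <[u]>).
  exists (U + <[u]>)%VS => // w /memv_addP[v vU [_ /vlineP[a ->] ->]].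
  by apply: TD; [exact: UT|exact: TZ].
rewrite -Uk leqNgt => /negP; apply.
rewrite (ltn_leqif (dimv_leqif_sup (addvSl U <[u]>))).
by apply: contra uU; rewrite subv_add => /andP[_]; rewrite -memvE.
Qed.

Lemma norm_lfun_mx (R : realType) (n : nat) (f : 'End('M[R]_n)) :
  exists2 C, 1 <= C & forall A, `|f A| <= C * `|A|.
Proof.
exists (1 + \sum_i \sum_j `|f (delta_mx i j)|).
  by rewrite lerDl !sumr_ge0// => i _; rewrite sumr_ge0.
move=> A; apply: (@le_trans _ _ ((\sum_i \sum_j `|f (delta_mx i j)|) * `|A|)).
  rewrite {1}[A]matrix_sum_delta linear_sum mulr_suml.
  apply: le_trans (ler_norm_sum _ _ _) _; apply: ler_sum => i _.
  rewrite linear_sum mulr_suml.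
  apply: le_trans (ler_norm_sum _ _ _) _; apply: ler_sum => j _.
  by rewrite linearZ normrZ mulrC ler_wpM2l// le_entry_norm.
by rewrite ler_wpM2r// lerDr.
Qed.

Lemma tangent_projection (R : realType) (n : nat) (G : set 'M[R]_n) :
  matrix_lie_group G -> exists P : 'End('M[R]_n),
  (forall X, tangent G (P X)) /\ (forall X, tangent G X -> P X = X).
Proof.
move=> hG; have [U UP] := vspace_of_set (tangent0 hG) (tangentD hG) (tangentZ hG).
exists (projv U); split => [X|X /UP]; first by apply/UP; exact: memv_proj.
exact: projv_id.
Qed.

(** * Minima over compact sets, continuity and separation *)

Lemma compact_min_continuous (R : realType) (T X : topologicalType)
    (L : set T) (phi : T -> X -> R) :
  compact L -> L !=set0 ->
  (forall g0 y0 (e : R), L g0 -> 0 < e -> \forall g \near g0 & y \near y0,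
     L g -> `|phi g y - phi g0 y0| <= e) ->
  exists m : X -> R, [/\ forall y, exists2 g, L g & m y = phi g y,
    forall y g, L g -> m y <= phi g y & continuous m].
Proof.
move=> cL L0 hphi.
have phi1 g0 y (e : R) : L g0 -> 0 < e ->
    \forall g \near g0, L g -> `|phi g y - phi g0 y| <= e.
  move=> Lg0 e0; have [[A B] /= [nA nB] AB] := hphi g0 y e Lg0 e0.
  apply: filterS nA => g Ag; apply: (AB (g, y)); split => //.
  exact: nbhs_singleton.
have attained y : exists g, L g /\ forall g', L g' -> phi g y <= phi g' y.
  have [] := @compact_EVT_min T R (phi ^~ y) L L0 cL.
    apply/subspace_continuousP => g0 Lg0; apply/cvgrPdist_le => e e0.
    apply: filterS (phi1 g0 y e Lg0 e0) => g /=; rewrite distrC; exact.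
  move=> g /set_mem Lg min; exists g; split => // g' Lg'.
  by apply: min; exact/mem_set.
have [s sP] := choice attained.
exists (fun y => phi (s y) y); split => [y|y g Lg|y0].
- by exists (s y) => //; have [] := sP y.
- by have [_] := sP y; exact.
apply/cvgrPdist_le => e e0.
(* Closeness uniform over the compact [L]; functions of [g] that are uniformly close have close
   minima. *)
have : \forall y \near y0, L `<=` [set g | `|phi g y - phi g y0| <= e].
  have /compact_near_coveringP/near_covering_withinP cov := cL.
  apply: cov => g0 Lg0; have e20 : 0 < e / 2 by lra.
  have [[A B] /= [nA nB] AB] := hphi g0 y0 (e / 2) Lg0 e20.
  exists (A, B) => // -[g y] /= [Ag By] Lg.
  have /= h1 := AB (g, y) (conj Ag By) Lg.
  have /= h2 := AB (g, y0) (conj Ag (nbhs_singleton nB)) Lg.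
  have := ler_distD (phi g0 y0) (phi g y) (phi g y0).
  by rewrite [`|phi g0 y0 - _|]distrC /=; lra.
apply: filterS => y hy /=.
have [Lsy miny] := sP y; have [Lsy0 miny0] := sP y0.
have /= := hy _ Lsy; have /= := hy _ Lsy0; have := miny _ Lsy0; have := miny0 _ Lsy.
by rewrite !ler_norml; lra.
Qed.

Lemma nbhs_norm_le (R : realType) (V : normedModType R) (a : V) (r : R) :
  0 < r -> \forall b \near a, `|b - a| <= r.
Proof.
move=> r0; apply: filterS (nbhsx_ballx a r r0) => b.
by rewrite -ball_normE /= distrC => /ltW.
Qed.

Lemma continuous_dist (R : realType) (V : normedModType R) (a : V) :
  continuous (fun b => `|b - a|).
Proof.
move=> b; apply/(@cvgrPdist_le _ _ _ (nbhs b)) => e e0.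
have := nbhs_norm_le b e0; apply: filterS => v vb.
by rewrite (le_trans (ler_dist_dist _ _))// opprB addrA subrK distrC.
Qed.

Lemma continuous_norm_le (R : realType) (Y : topologicalType) (V : normedModType R)
    (f : Y -> V) (y : Y) (r : R) :
  continuous f -> 0 < r -> \forall z \near y, `|f z - f y| <= r.
Proof. by move=> cf r0; exact: (cf y _ (nbhs_norm_le (f y) r0)). Qed.

Lemma nbhs_norm_leP (R : realType) (V : normedModType R) (a : V) (A : set V) :
  nbhs a A -> exists2 r : R, 0 < r & forall b, `|b - a| <= r -> A b.
Proof.
move=> /nbhs_ballP[r /= r0 rA]; exists (r / 2); first lra.
by move=> b hb; apply: rA; rewrite -ball_normE /= distrC; lra.
Qed.

Lemma closed_dist_ge (R : realType) (V : normedModType R) (a : V) (r : R) :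
  closed [set b | r <= `|b - a|].
Proof.
apply: (@preimage_closed _ _ (fun b => `|b - a|) [set s | r <= s]).
  by move=> b _; exact: continuous_dist.
exact: closed_ge.
Qed.

Lemma compact_nbhs_subset (R : realType) (X : topologicalType) (x : X)
    (W : set X) :
  locally_compact [set: X] -> hausdorff_space X ->
  nbhs x W ->
  exists D, [/\ nbhs x D, compact D & D `<=` W].
Proof.
move=> hXlc hXh nW; have [U] := hXlc x I; rewrite withinET => nU [cU clU].
have reg := completely_regular_regular (R := R)
  (@locally_compact_completely_regular X R hXlc hXh).
have [V nV VW] := reg x W nW.
exists (closure V `&` U); split.
- by apply: filterI => //; apply: filterS nV; exact: subset_closure.
- by rewrite setIC; apply: compact_closedI => //; exact: closed_closure.
- by move=> y [/VW].
Qed.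

(** * Small balls in [G] and joint continuity of the action *)

Section Action.
Context {R : realType} {n : nat} (G : set 'M[R]_n) {X : topologicalType}.
Context (act : 'M[R]_n -> X -> X).
Hypotheses (hG : matrix_lie_group G) (hact : continuous_action G act).
Implicit Types (g h : 'M[R]_n) (x y : X).
Local Notation c := (@mulmx_cst R n).

Definition group_ball (r : R) : set 'M[R]_n := [set g | G g /\ `|g - 1%:M| <= r].

Lemma group_ball1 r : 0 < r -> group_ball r 1%:M.
Proof.
by move=> r0; split; [exact: mlg_one|rewrite subrr normr0 ltW].
Qed.

(** As [G] is closed only in the general linear group, compactness is inherited from [K]: a small
    ball of [G] lies in [K] and is closed in it. *)
Lemma compact_group_ball (K : set 'M[R]_n) : compact_identity_nbhd G K ->
  exists2 r0 : R, 0 < r0 & forall r : R, r <= r0 ->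
    compact (group_ball r) /\ group_ball r `<=` K.
Proof.
move=> [KG cK]; rewrite [nbhs _ _]/nbhs /= -nbhs_subspace_in; last exact: mlg_one.
move=> /nbhs_norm_leP[r0 r00 r0K]; exists r0 => // r rr0.
have rK : group_ball r `<=` K.
  by move=> g [Gg gr]; apply: r0K => //; exact: le_trans rr0.
split => //.
have -> : group_ball r = K `&` [set g | `|g - 1%:M| <= r].
  by apply/seteqP; split => [g gr|g [/KG]//]; split; [exact: rK|case: gr].
apply: compact_closedI => //.
apply: (@preimage_closed _ _ (fun g => `|g - 1%:M|) [set s | s <= r]).
  by move=> g _; exact: continuous_dist.
exact: closed_le.
Qed.

Lemma act_near g0 y0 (U : set X) : G g0 -> nbhs (act g0 y0) U ->
  \forall g \near g0 & y \near y0, G g -> U (act g y).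
Proof.
move=> Gg0 nU; have /subspace_continuousP := act_continuous hact.
move=> /(_ (g0, y0) (conj Gg0 I) U nU) [[A B] /= nAB AB].
by exists (A, B) => // -[g y] /= ABgy Gg; exact: (AB (g, y)).
Qed.

Lemma act_comp_near (f : X -> R) g0 y0 (e : R) : continuous f -> G g0 -> 0 < e ->
  \forall g \near g0 & y \near y0,
    G g -> `|f (act g y) - f (act g0 y0)| <= e.
Proof.
move=> cf Gg0 e0.
apply: (@act_near g0 y0 [set z | `|f z - f (act g0 y0)| <= e] Gg0).
exact: continuous_norm_le.
Qed.

Lemma act_invmx g y z : G g -> act g y = z -> act (invmx g) z = y.
Proof.
move=> Gg <-; rewrite -(act_mul hact)//; last exact: mlg_inv.
by rewrite mulVmx ?(act_one hact)//; exact: (mlg_sub hG).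
Qed.

End Action.

(** * An almost equivariant matrix-valued map near [x] *)

Section Coordinates.
Context {R : realType} {n : nat} (G : set 'M[R]_n) {X : topologicalType}.
Context (act : 'M[R]_n -> X -> X).
Hypotheses (hG : matrix_lie_group G) (hact : continuous_action G act).
Hypotheses (hfree : free_action G act) (hXlc : locally_compact [set: X]).
Hypothesis hXh : hausdorff_space X.
Implicit Types (g h : 'M[R]_n) (x y : X).
Local Notation c := (@mulmx_cst R n).

(** By freeness [x] is not in the orbit piece [L x], which is compact and hence closed, so complete
    regularity separates the two. *)
Lemma urysohn_orbit x (L : set 'M[R]_n) :
  L `<=` G -> compact L -> ~ L 1%:M ->
  exists f : X -> R, [/\ continuous f, f x = 0 &
    forall g, L g -> f (act g x) = 1].
Proof.
move=> LG cL L1; pose B := (act ^~ x) @` L.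
have cB : closed B.
  apply: compact_closed => //; apply: continuous_compact => //.
  apply/subspace_continuousP => g Lg U nU.
  have [[A C] /= [nA nC] AC] := act_near hact (LG _ Lg) nU.
  apply: filterS nA => h Ah Lh; apply: (AC (h, x)) (LG _ Lh).
  by split => //; exact: nbhs_singleton.
have nBx : ~ B x.
  by move=> [g Lg gx]; apply: L1; rewrite -(hfree (LG _ Lg) gx).
have := @locally_compact_completely_regular X R hXlc hXh x B cB nBx.
move=> /(uniform_separatorP (R := R))[f [cf _ f0 f1]]; exists f; split => //.
  by apply: f0; exists x.
by move=> g Lg; apply: f1; exists (act g x) => //; exists g.
Qed.

Lemma almost_equivariant_map K x (e : R) : compact_identity_nbhd G K -> 0 < e ->
  exists F : X -> 'M[R]_n, exists2 rho, 0 < rho &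
  (forall y0 (d : R), 0 < d -> \forall y \near y0, `|F y - F y0| <= d) /\
  exists2 W, nbhs x W & forall y h, W y -> W (act h y) -> G h ->
    `|h - 1%:M| <= rho -> `|F (act h y) - F y - (h - 1%:M)| <= e * `|h - 1%:M|.
Proof.
move=> hK e0; have c1 := @mulmx_cst_ge1 R n.
have [r0 r00 Hr0] := compact_group_ball hG hK.
have [r [r_gt0 rr0 rce rc]] : exists r,
    [/\ 0 < r, r <= r0, r * (2 * c ^+ 2) <= e & r * c <= 1].
  have c20 : 0 < 2 * c ^+ 2 by rewrite mulr_gt0// exprn_gt0//; lra.
  have c0 : 0 < c by lra.
  exists (Num.min r0 (Num.min (e / (2 * c ^+ 2)) (1 / c))); split.
  - by rewrite !lt_min r00 !divr_gt0.
  - by rewrite ge_min lexx.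
  - by rewrite -ler_pdivlMr// !ge_min lexx orbT.
  - by rewrite -ler_pdivlMr// !ge_min lexx !orbT.
have [cL LK] := Hr0 _ rr0; move: cL LK; set L := group_ball G r => cL LK.
have LG : L `<=` G by move=> g [].
have L1 : L 1%:M by exact: group_ball1.
(* On this annulus the cut-off is large, which keeps minimizers away from the boundary of [L]. *)
pose L' := L `&` [set g | r / 2 <= `|g - 1%:M|].
have cL' : compact L'.
  by apply: compact_closedI => //; exact: (@closed_dist_ge R 'M[R]_n).
have [||f [cf fx0 fL']] := @urysohn_orbit x L' _ cL'.
- by move=> g [/LG].
- by move=> [_ /=]; rewrite subrr normr0; lra.
pose W z := f z <= 1 / 5 /\ forall g, L' g -> 1 / 2 <= f (act g z).
have nW : nbhs x W.
  apply: filterI.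
    have half : 0 < 1 / 5 :> R by lra.
    have := continuous_norm_le x cf half; apply: filterS => z /=.
    by rewrite fx0 subr0 ler_norml => /andP[].
  have /compact_near_coveringP/near_covering_withinP cov := cL'.
  apply: cov => g Lg; have half : 0 < 1 / 2 :> R by lra.
  have Gg : G g by case: Lg => /LG.
  have [[A B] /= nAB AB] := act_comp_near hact x cf Gg half.
  exists (A, B) => // -[h y] /= ABhy Lh; have Gh : G h by case: Lh => /LG.
  by have /= := AB (h, y) ABhy Gh; rewrite fL'// ler_norml; lra.
(* The factor [4 r] makes the cut-off win over the linear term: for [z] in [W], [phi] is at least
   [2 r - r] on the annulus but at most [4 r / 5] at [g = 1]. Hence minimizers satisfy
   [|g - 1| < r / 2]. *)
pose phi i j g y := 4 * r * f (act g y) - (g - 1%:M) i j.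
have hphi i j g0 y0 (d : R) : L g0 -> 0 < d -> \forall g \near g0 & y \near y0,
    L g -> `|phi i j g y - phi i j g0 y0| <= d.
  move=> Lg0 d0; have d1 : 0 < d / 2 by lra.
  have d2 : 0 < d / (8 * r) by rewrite divr_gt0//; lra.
  have [[A B] /= [nA nB] AB] := act_comp_near hact y0 cf (LG _ Lg0) d2.
  have nA' : nbhs g0 (A `&` [set g | `|g - g0| <= d / 2]).
    by apply: filterI; [exact: nA|exact: (@nbhs_norm_le R 'M[R]_n g0 _ d1)].
  exists (A `&` [set g | `|g - g0| <= d / 2], B) => // -[g y] /= [[Ag gg0] By] Lg.
  have /= := AB (g, y) (conj Ag By) (LG _ Lg).
  rewrite ler_pdivlMr => [fd|]; last lra.
  have : `|4 * r * (f (act g y) - f (act g0 y0))| <= d / 2.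
    by rewrite normrM gtr0_norm; lra.
  have := le_trans (le_entry_norm (g - g0) i j) gg0.
  rewrite /phi !mxE !ler_norml; lra.
have mex i j : exists mij : X -> R,
    [/\ forall y, exists2 g, L g & mij y = phi i j g y,
      forall y g, L g -> mij y <= phi i j g y & continuous mij].
  by apply: compact_min_continuous; [|exists 1%:M|exact: hphi].
have mex' i := choice (mex i).
have [m mP] := choice (fun i => let: existT mi miP := mex' i in ex_intro _ mi miP).
have inner z i j g : W z -> L g -> m i j z = phi i j g z -> `|g - 1%:M| < r / 2.
  move=> [fz fL] Lg mg; rewrite ltNge; apply/negP => rg.
  have [_ /(_ z 1%:M L1) + _] := mP i j.
  have -> : phi i j 1%:M z = 4 * r * f z.
    by rewrite /phi (act_one hact) subrr mxE subr0.
  rewrite mg /phi => le1.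
  have := le_entry_norm (g - 1%:M) i j; rewrite ler_norml.
  have : 0 <= r * (f (act g z) - 1 / 2).
    by apply: mulr_ge0; [|have := fL g (conj Lg rg)]; lra.
  have : 0 <= r * (1 / 5 - f z) by apply: mulr_ge0; lra.
  by case: Lg => _; lra.
(* Test the minimum at [y] with [g h], where [g] is a minimizer at [h y]. The values of [f] cancel,
   and only the entry of [(g - 1)(h - 1)] is left as an error. *)
have half y h i j : W (act h y) -> G h -> `|h - 1%:M| <= r / 4 ->
    m i j y - m i j (act h y) + (h - 1%:M) i j <= c * (r / 2) * `|h - 1%:M|.
  move=> Whz Gh hr; have [/(_ (act h y))[g Lg mg] _ _] := mP i j.
  have gr := inner _ _ _ _ Whz Lg mg.
  have E : g *m h - 1%:M = (g - 1%:M) + (h - 1%:M) + (g - 1%:M) *m (h - 1%:M).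
    rewrite mulmxBr mulmx1 mulmxBl mul1mx; move: (g *m h) => H.
    by apply/matrixP => k l; rewrite !mxE; ring.
  have N : `|(g - 1%:M) *m (h - 1%:M)| <= c * (r / 2) * `|h - 1%:M|.
    apply: le_trans (norm_mulmx _ _) _; rewrite ler_wpM2r// ler_pM2l; lra.
  have Lgh : L (g *m h).
    split; first by apply: mlg_mul => //; exact: LG.
    rewrite E; have := ler_normD (g - 1%:M + (h - 1%:M)) ((g - 1%:M) *m (h - 1%:M)).
    have := ler_normD (g - 1%:M) (h - 1%:M).
    have : c * (r / 2) * `|h - 1%:M| <= r / 4 by have := normr_ge0 (h - 1%:M); nra.
    lra.
  have [_ /(_ y _ Lgh) + _] := mP i j.
  rewrite mg /phi (act_mul hact) ?E//; last exact: LG.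
  have := le_entry_norm ((g - 1%:M) *m (h - 1%:M)) i j; rewrite ler_norml.
  move: ((g - 1%:M) *m (h - 1%:M)) N => Z N; rewrite !mxE; lra.
(* The radius keeps both [h - 1] and [h^-1 - 1] below [r / 4], the latter being at most
   [2 c |h - 1|]. The reverse inequality is then [half] for [h^-1] at the point [h y]. *)
exists (fun y => \matrix_(i, j) m i j y), (r / (8 * c)).
  by rewrite divr_gt0//; lra.
split => [y0 d d0|].
  have : \forall y \near y0, forall i j, `|m i j y - m i j y0| <= d.
    apply: filter_forall => i; apply: filter_forall => j.
    by have [_ _ cm] := mP i j; exact: continuous_norm_le.
  apply: filterS => y hy; apply: norm_le_entries => [|i j]; first exact: ltW.
  by rewrite !mxE.
exists W => // y h Wy Why Gh; rewrite ler_pdivlMr; last lra; move=> hr.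
have h0 := normr_ge0 (h - 1%:M).
have uh : h \in unitmx by exact: (mlg_sub hG).
have hV : `|invmx h| <= 2 by apply: norm_invmx => //; nra.
set k := invmx h.
have Ek : k - 1%:M = - (k *m (h - 1%:M)).
  by rewrite mulmxBr mulVmx// mulmx1 opprB.
(* Up to a quadratic error, [h^-1 - 1] is [- (h - 1)]. *)
have Ekh : (k - 1%:M) + (h - 1%:M) = k *m (h - 1%:M) *m (h - 1%:M).
  rewrite -[k *m _]opprK -Ek mulNmx mulmxBl mul1mx mulmxBr mulVmx// mulmx1.
  by apply/matrixP => i j; rewrite !mxE; ring.
have Nk : `|k - 1%:M| <= 2 * c * `|h - 1%:M|.
  rewrite Ek normrN (le_trans (norm_mulmx _ _))// ler_wpM2r//.
  by rewrite mulrC ler_pM2r//; lra.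
have Nkh : `|(k - 1%:M) + (h - 1%:M)| <= 2 * c * c * `|h - 1%:M| * `|h - 1%:M|.
  rewrite Ekh (le_trans (norm_mulmx _ _))// ler_wpM2r//.
  move: Nk; rewrite Ek normrN => Nk; nra.
apply: norm_le_entries => [|i j]; first by rewrite mulr_ge0// ltW.
have hr4 : `|h - 1%:M| <= r / 4 by nra.
have hk4 : `|k - 1%:M| <= r / 4 by nra.
have A1 := half y h i j Why Gh hr4.
have ky : act k (act h y) = y by exact: (act_invmx hG hact).
have := half (act h y) k i j; rewrite ky => /(_ Wy (mlg_inv hG Gh) hk4) A2.
have := le_entry_norm ((k - 1%:M) + (h - 1%:M)) i j.
have B1 : c * (r / 2) * `|h - 1%:M| <= e * `|h - 1%:M| by rewrite ler_wpM2r//; nra.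
have B2 : c * (r / 2) * `|k - 1%:M| <= e / 2 * `|h - 1%:M|.
  apply: (@le_trans _ _ (c * (r / 2) * (2 * c * `|h - 1%:M|))).
    by rewrite ler_wpM2l// mulr_ge0//; lra.
  by rewrite mulrA ler_wpM2r//; nra.
have B3 : 2 * c * c * `|h - 1%:M| * `|h - 1%:M| <= e / 2 * `|h - 1%:M|.
  by rewrite ler_wpM2r//; nra.
move: A1 A2 Nkh; rewrite !mxE !ler_norml; lra.
Qed.

End Coordinates.

(** Writing [g'^-1 g - 1] as [(g0^-1 g')^-1 g0^-1 (g - g')] makes it small: the first factor has
    norm at most 2, since [g0^-1 g'] is close to 1. *)
Lemma invmx_mulmx_near (R : realType) (n : nat) (g0 : 'M[R]_n) (rho : R) :
  g0 \in unitmx -> 0 < rho ->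
  exists2 s : R, 0 < s & forall g g', g' \in unitmx -> `|g - g0| <= s ->
    `|g' - g0| <= s -> `|invmx g' *m g - 1%:M| <= rho.
Proof.
move=> u0 rho0; set c := @mulmx_cst R n.
have c1 : 1 <= c := @mulmx_cst_ge1 R n; set k0 := invmx g0.
have k00 := normr_ge0 k0.
have q0 : 0 < 4 * c ^+ 2 * (`|k0| + 1).
  by rewrite !mulr_gt0// ?exprn_gt0//; lra.
have [s [s0 s1 srho]] : exists s : R, [/\ 0 < s,
    s * (4 * c ^+ 2 * (`|k0| + 1)) <= 1 & s * (4 * c ^+ 2 * (`|k0| + 1)) <= rho].
  exists (Num.min (1 / (4 * c ^+ 2 * (`|k0| + 1)))
    (rho / (4 * c ^+ 2 * (`|k0| + 1)))); split.
  - by rewrite lt_min !divr_gt0.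
  - by rewrite -ler_pdivlMr// ge_min lexx.
  - by rewrite -ler_pdivlMr// ge_min lexx orbT.
exists s => // g g' u' hg hg'.
have ua : k0 *m g' \in unitmx by rewrite unitmx_mul unitmx_inv u0.
have a1 : `|k0 *m g' - 1%:M| <= c * `|k0| * s.
  have -> : k0 *m g' - 1%:M = k0 *m (g' - g0) by rewrite mulmxBr mulVmx.
  by rewrite (le_trans (norm_mulmx _ _))// ler_wpM2l// mulr_ge0//; lra.
have aV : `|invmx (k0 *m g')| <= 2.
  apply: norm_invmx => //; apply: (@le_trans _ _ (c * (c * `|k0| * s))).
    by rewrite ler_pM2l//; lra.
  have : 0 <= s * c ^+ 2 by rewrite mulr_ge0 ?sqr_ge0//; lra.
  have : 0 <= s * c ^+ 2 * `|k0| by rewrite !mulr_ge0 ?sqr_ge0//; lra.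
  lra.
have -> : invmx g' *m g - 1%:M = invmx (k0 *m g') *m k0 *m (g - g').
  rewrite mulmxBr -[X in _ = _ - X]mulmxA mulVmx//; congr (_ *m _ - _).
  by rewrite -[RHS](mulmxK u') -[X in _ = X *m _]mulmxA mulVmx// mul1mx.
have gg : `|g - g'| <= 2 * s.
  by have := ler_distD g0 g g'; rewrite [`|g0 - _|]distrC; lra.
apply: (le_trans (norm_mulmx _ _)).
have kk : `|invmx (k0 *m g') *m k0| <= c * 2 * (`|k0| + 1).
  apply: (le_trans (norm_mulmx _ _)).
  by apply: ler_pM => //; [rewrite mulr_ge0//; lra|rewrite ler_pM2l; lra|lra].
apply: le_trans srho.
have -> : s * (4 * c ^+ 2 * (`|k0| + 1)) = c * (c * 2 * (`|k0| + 1)) * (2 * s).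
  by ring.
by apply: ler_pM => //; [rewrite mulr_ge0//; lra|rewrite ler_pM2l; lra].
Qed.

(** * The coordinate along orbits, local injectivity and descent *)

Section Slices.
Context {R : realType} {n : nat} (G : set 'M[R]_n) {X : topologicalType}.
Context (act : 'M[R]_n -> X -> X).
Hypotheses (hG : matrix_lie_group G) (hact : continuous_action G act).
Hypotheses (hfree : free_action G act) (hXlc : locally_compact [set: X]).
Hypothesis hXh : hausdorff_space X.
Implicit Types (g h : 'M[R]_n) (x y : X).
Local Notation c := (@mulmx_cst R n).

(* [H] measures displacement along the orbits: its differential in the group
   direction is close to the projection [P] onto the tangent space at [1]. *)
Lemma orbit_coordinate K x : compact_identity_nbhd G K ->
  exists P : 'End('M[R]_n), exists H : X -> 'M[R]_n,
  exists2 rho : R, 0 < rho &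
  [/\ forall Z, tangent G Z -> P Z = Z, forall y, tangent G (H y), H x = 0,
    continuous H & exists2 W, nbhs x W & forall y h, W y -> W (act h y) ->
      G h -> `|h - 1%:M| <= rho ->
      `|H (act h y) - H y - P (h - 1%:M)| <= 1 / 8 * `|h - 1%:M| /\
      1 / 2 * `|h - 1%:M| <= `|H (act h y) - H y|].
Proof.
move=> hK; have [P [PT Pid]] := tangent_projection hG.
have [C C1 PC] := norm_lfun_mx P.
pose e := 1 / (8 * C).
have Ce : C * e = 1 / 8 by rewrite /e; field; lra.
have e0 : 0 < e by rewrite divr_gt0//; lra.
have e8 : e <= 1 / 8 by nra.
have [d d0 hd] := near_tangent hG e0.
have [F [rho rho0 [cF [W nW hW]]]] :=
  almost_equivariant_map hG hact hfree hXlc hXh x hK e0.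
exists P, (fun y => P (F y - F x)), (Num.min rho d).
  by rewrite lt_min rho0.
split=> //.
- by rewrite subrr linear0.
- move=> y0; apply/(@cvgrPdist_le _ _ _ (nbhs y0)) => b b0.
  have bC : 0 < b / C by rewrite divr_gt0//; lra.
  have := cF y0 _ bC; apply: filterS => y hy.
  rewrite distrC -linearB opprB addrA subrK (le_trans (PC _))//.
  by rewrite mulrC -ler_pdivlMr//; lra.
exists W => // y h Wy Why Gh; rewrite le_min => /andP[hrho hhd].
have h0 := normr_ge0 (h - 1%:M).
have D : `|P (F (act h y) - F x) - P (F y - F x) - P (h - 1%:M)| <=
    1 / 8 * `|h - 1%:M|.
  have -> : P (F (act h y) - F x) - P (F y - F x) - P (h - 1%:M) =
      P (F (act h y) - F y - (h - 1%:M)).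
    by rewrite -!linearB opprB addrA subrK.
  apply: (le_trans (PC _)); have -> : 1 / 8 * `|h - 1%:M| = C * (e * `|h - 1%:M|).
    by rewrite mulrA Ce.
  by rewrite ler_pM2l; [exact: hW|lra].
split => //; have [Z TZ hZ] := hd h Gh hhd.
(* As [P] fixes [Z], only the part [h - 1 - Z] is affected by [1 - P]. This gives
   [|P (h - 1)| >= 3/4 |h - 1|], and the error [1/8 |h - 1|] still leaves more than one half. *)
have E : h - 1%:M = P (h - 1%:M) + ((h - 1%:M - Z) - P (h - 1%:M - Z)).
  rewrite [P (h - 1%:M - Z)]linearB/= (Pid Z)//; move: (P _) => A.
  by apply/matrixP => i j; rewrite !mxE; ring.
have N : `|h - 1%:M| <= `|P (h - 1%:M)| +
    (`|h - 1%:M - Z| + `|P (h - 1%:M - Z)|).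
  by rewrite {1}E (le_trans (ler_normD _ _))// lerD2l ler_normB.
have N2 : `|P (h - 1%:M - Z)| <= 1 / 8 * `|h - 1%:M|.
  apply: (le_trans (PC _)); have -> : 1 / 8 * `|h - 1%:M| = C * (e * `|h - 1%:M|).
    by rewrite mulrA Ce.
  by rewrite ler_pM2l//; lra.
have N3 : `|h - 1%:M - Z| <= 1 / 8 * `|h - 1%:M|.
  by rewrite (le_trans hZ)// ler_wpM2r.
move: D; set A := P (F (act h y) - F x) - P (F y - F x) => D.
have := ler_normB A (A - P (h - 1%:M)).
rewrite opprB addrC subrK; lra.
Qed.

(** Compactness of [K * K]. Near a diagonal pair the quotient is close to 1 anyway; near a pair
    [g0 <> g0'], freeness and the Hausdorff property separate [g0 x] from [g0' x], so [g y = g' y']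
    is impossible for [y], [y'] near [x]. *)
Lemma near_injective K x (rho : R) : K `<=` G -> compact K -> 0 < rho ->
  exists2 W, nbhs x W & forall g g' y y', K g -> K g' -> W y -> W y' ->
    act g y = act g' y' -> `|invmx g' *m g - 1%:M| <= rho.
Proof.
move=> KG cK rho0.
pose Q (p : X * X) := [set q : 'M[R]_n * 'M[R]_n |
  act q.1 p.1 = act q.2 p.2 -> `|invmx q.2 *m q.1 - 1%:M| <= rho].
have /compact_near_coveringP/near_covering_withinP cov := compact_setX cK cK.
have [[A B] /= [nA nB] AB] : \forall p \near (x, x), K `*` K `<=` Q p.
  apply: (cov (X * X)%type (nbhs (x, x)) Q) => -[g0 g0'] /= [/KG Gg0 /KG Gg0'].
  have [eq0|neq] := pselect (g0 = g0').
    have [s s0 hs] := invmx_mulmx_near (mlg_sub hG Gg0) rho0.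
    have nb := @nbhs_norm_le R 'M[R]_n g0 s s0.
    exists ([set g | `|g - g0| <= s] `*` [set g | `|g - g0| <= s], setT).
      split; last exact: filterT.
      by rewrite -eq0; exists ([set g | `|g - g0| <= s], [set g | `|g - g0| <= s]).
    move=> [[g g'] p] /= [[gs g's] _] [_ /KG Gg'] _.
    by apply: hs => //; exact: (mlg_sub hG).
  have neqx : act g0 x != act g0' x.
    apply/eqP => E; apply: neq.
    have : act (invmx g0' *m g0) x = x.
      rewrite (act_mul hact)//; last exact: mlg_inv.
      exact: (act_invmx hG hact).
    move=> /(hfree (mlg_mul hG (mlg_inv hG Gg0') Gg0)) /(congr1 (mulmx g0')).
    by rewrite mulmxA mulmxV ?mul1mx ?mulmx1//; exact: (mlg_sub hG).
  have := hXh; rewrite open_hausdorff => /(_ _ _ neqx)[[U V] /=].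
  rewrite !inE => -[Ug0 Vg0'] [oU oV UV].
  have [[A1 B1] /= [nA1 nB1] AB1] :=
    act_near hact Gg0 (open_nbhs_nbhs (conj oU Ug0)).
  have [[A2 B2] /= [nA2 nB2] AB2] :=
    act_near hact Gg0' (open_nbhs_nbhs (conj oV Vg0')).
  exists (A1 `*` A2, B1 `*` B2).
    by split; [exists (A1, A2)|exists (B1, B2)].
  move=> [[g g'] [y y']] /= [[Ag Ag'] [By By']] [/KG Gg /KG Gg'] E.
  have /= U1 := AB1 (g, y) (conj Ag By) Gg.
  have /= V1 := AB2 (g', y') (conj Ag' By') Gg'.
  have : (U `&` V) (act g y) by split => //; rewrite E.
  by rewrite UV.
exists (A `&` B); first exact: filterI.
move=> g g' y y' Kg Kg' [Ay _] [_ By'].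
exact: (AB (y, y') (conj Ay By') (g, g') (conj Kg Kg')).
Qed.

(* Moving along a group element close to [1 - t H(hy)] shrinks [H]. *)
Lemma descent (P : 'End('M[R]_n)) (H : X -> 'M[R]_n) (rho r : R) (y : X) h :
  (forall Z, tangent G Z -> P Z = Z) -> (forall y, tangent G (H y)) ->
  0 < rho -> G h -> `|h - 1%:M| < r -> H (act h y) != 0 ->
  (forall k, G k -> `|k - 1%:M| <= rho -> `|k *m h - 1%:M| <= r ->
    `|H (act (k *m h) y) - H (act h y) - P (k - 1%:M)| <= 1 / 8 * `|k - 1%:M|) ->
  exists2 k, group_ball G r k & `|H (act k y)| < `|H (act h y)|.
Proof.
move=> Pid HT rho0 Gh hr v0 hH; set v := H (act h y) in v0 hH *.
have c1 := @mulmx_cst_ge1 R n.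
have [C C1 PC] := norm_lfun_mx P.
have nv : 0 < `|v| by rewrite normr_gt0.
have e0 : 0 < `|v| / (8 * C) by rewrite divr_gt0//; lra.
have [d d0 hd] := tangentN hG (HT (act h y)) e0.
have h0 := normr_ge0 h.
have q0 : 0 < 2 * c * `|v| * (`|h| + 1) by rewrite !mulr_gt0//; lra.
(* The bounds on [t] serve, in order, to realize [- v], to keep [1 - t] nonnegative, to keep [k]
   within [rho] of 1, and to keep [k h] in the ball of radius [r]. *)
have [t [t0 td t1 trho tr]] : exists t : R, [/\ 0 < t, t < d, t <= 1,
    t * (2 * `|v|) <= rho &
    t * (2 * c * `|v| * (`|h| + 1)) <= r - `|h - 1%:M|].
  exists (Num.min (d / 2) (Num.min 1 (Num.min (rho / (2 * `|v|))
    ((r - `|h - 1%:M|) / (2 * c * `|v| * (`|h| + 1)))))); split.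
  - by rewrite !lt_min !divr_gt0//; lra.
  - by rewrite gt_min; apply/orP; left; lra.
  - by rewrite !ge_min lexx !orbT.
  - by rewrite -ler_pdivlMr ?mulr_gt0// !ge_min lexx !orbT.
  - by rewrite -ler_pdivlMr// !ge_min lexx !orbT.
have [|k Gk hk] := hd t; first by rewrite t0.
move: hk; rewrite scalerN opprK -/v => hk.
have ev : `|v| / (8 * C) <= `|v| / 8.
  by rewrite ler_pM2l// lef_pV2 ?posrE; lra.
have k1 : `|k - 1%:M| <= 9 / 8 * (t * `|v|).
  have := ler_normB (k - 1%:M + t *: v) (t *: v).
  rewrite addrK normrZ (gtr0_norm t0).
  have : `|v| / (8 * C) * t <= `|v| / 8 * t by rewrite ler_pM2r.
  lra.
have tv : 0 < t * `|v| by rewrite mulr_gt0.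
have kh : `|k *m h - 1%:M| <= r.
  have -> : k *m h - 1%:M = (k - 1%:M) *m h + (h - 1%:M).
    by rewrite mulmxBl mul1mx addrA subrK.
  rewrite (le_trans (ler_normD _ _))//.
  have := norm_mulmx (k - 1%:M) h.
  have : c * `|k - 1%:M| * `|h| <= c * (2 * (t * `|v|)) * (`|h| + 1).
    by rewrite ler_pM// ?mulr_ge0// ?ler_pM2l//; lra.
  have -> : c * (2 * (t * `|v|)) * (`|h| + 1) =
    t * (2 * c * `|v| * (`|h| + 1)) by ring.
  lra.
exists (k *m h); first by split => //; exact: mlg_mul.
have hk' : `|k - 1%:M| <= rho by lra.
have D := hH k Gk hk' kh.
(* The two error terms are at most [9/64] and [1/8] of [t |v|], less than the gain [t |v|] of the
   main term. *)
have Ev : H (act (k *m h) y) = (1 - t) *: v +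
    (H (act (k *m h) y) - v - P (k - 1%:M)) + P (k - 1%:M + t *: v).
  rewrite [P (_ + t *: v)]linearD/= [P (t *: v)]linearZ/= (Pid v); last exact: HT.
  rewrite scalerBl scale1r; move: (H _) (P _) => A B.
  by apply/matrixP => i j; rewrite !mxE; ring.
have Q : `|P (k - 1%:M + t *: v)| <= 1 / 8 * (t * `|v|).
  rewrite (le_trans (PC _))//.
  have -> : 1 / 8 * (t * `|v|) = C * (`|v| / (8 * C) * t) by field; lra.
  by rewrite ler_pM2l//; lra.
rewrite Ev (le_lt_trans (ler_normD _ _))//.
have := ler_normD ((1 - t) *: v) (H (act (k *m h) y) - v - P (k - 1%:M)).
rewrite normrZ ger0_norm; last lra.
lra.
Qed.

End Slices.

(** * The slice and its tube *)

Theorem theorem3p14 (R : realType) (n : nat) (G : set 'M[R]_n)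
  (X : topologicalType) (act : 'M[R]_n -> X -> X)
  (hG : matrix_lie_group G)
  (hX2 : @second_countable X)
  (hXlc : locally_compact [set: X])
  (hXh : hausdorff_space X)
  (hact : continuous_action G act)
  (hfree : free_action G act) :
  admits_slices G act.
Proof.
move=> K x hK; have [KG cK _] := hK; set c := @mulmx_cst R n.
have c1 : 1 <= c := @mulmx_cst_ge1 R n.
have [P [H [rho rho0 [Pid HT Hx cH [W nW hW]]]]] :=
  orbit_coordinate hG hact hfree hXlc hXh x hK.
have [W' nW' hW'] := near_injective hG hact hfree hXh x KG cK rho0.
have [D [nD cD DW]] := compact_nbhs_subset R hXlc hXh (filterI nW nW').
have cN : continuous (fun y => `|H y - 0|).
  move=> y; apply: (@continuous_comp _ _ _ H (fun Z => `|Z - 0|));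
    [exact: cH|exact: continuous_dist].
pose S := D `&` [set y | H y = 0].
have SH : S = D `&` ((fun y => `|H y - 0|) @^-1` [set 0]).
  apply/seteqP; split => y /= [Dy /= Hy]; split => //=.
    by rewrite Hy subr0 normr0.
  by apply/normr0_eq0; rewrite -[H y]subr0.
exists S; split.
  split.
    rewrite SH; apply: compact_closedI => //; apply: preimage_closed => [y _|].
      exact: cN.
    exact: closed_eq.
  (* The element [g'^-1 g] moves [s] to [s'] and is within [rho] of 1. Since [H] vanishes at both
     points, the lower bound on its displacement forces [g'^-1 g = 1]. *)
  move=> [g s] [g' s']; rewrite !inE /= => -[Kg [Ds Hs]] [Kg' [Ds' Hs']] E.
  have [Ws Ws1] := DW _ Ds; have [Ws' Ws1'] := DW _ Ds'.
  have Gg := KG _ Kg; have Gg' := KG _ Kg'.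
  have hrho := hW' _ _ _ _ Kg Kg' Ws1 Ws1' E.
  have Gh : G (invmx g' *m g) by apply: mlg_mul => //; exact: mlg_inv.
  have hs : act (invmx g' *m g) s = s'.
    rewrite (act_mul hact)//; last exact: mlg_inv.
    exact: (act_invmx hG hact).
  have Whs : W (act (invmx g' *m g) s) by rewrite hs.
  have [_] := hW s _ Ws Whs Gh hrho.
  rewrite hs (_ : H s' = 0)// (_ : H s = 0)// subrr normr0 => h0.
  have /normr0_eq0/subr0_eq h1 : `|invmx g' *m g - 1%:M| = 0.
    by apply/eqP; rewrite eq_le normr_ge0 andbT; lra.
  have gg : g = g'.
    by rewrite -[g](mulKVmx (mlg_sub hG Gg')) h1 mulmx1.
  by rewrite gg -hs h1 (act_one hact).
split; first by split => //; exact: nbhs_singleton.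
have [r0 r00 Hr0] := compact_group_ball hG hK.
have nDx : nbhs (act 1%:M x) D by rewrite (act_one hact).
have [[A B] /= [nA nB] AB] := act_near hact (mlg_one hG) nDx.
have [r1 r10 r1A] := nbhs_norm_leP nA.
(* The bounds on [r] make the ball compact, keep its translates of [y] in [D], allow the estimates
   on [H], and finally put the inverses of its elements in [K]. *)
have [r [r_gt0 [rr0 rr1] rrho rc rc0]] : exists r : R, [/\ 0 < r, r <= r0 /\ r <= r1,
    r <= rho, r * (2 * c) <= 1 & r * (2 * c) <= r0].
  have c20 : 0 < 2 * c by lra.
  exists (Num.min r0 (Num.min r1 (Num.min rho
    (Num.min (1 / (2 * c)) (r0 / (2 * c)))))).
  split.
  - by rewrite !lt_min r00 r10 rho0 !divr_gt0.
  - by rewrite !ge_min !lexx !orbT.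
  - by rewrite !ge_min lexx !orbT.
  - by rewrite -ler_pdivlMr// !ge_min lexx !orbT.
  - by rewrite -ler_pdivlMr// !ge_min lexx !orbT.
have r8 : 0 < r / 8 by lra.
have nV : nbhs x (B `&` [set y | `|H y - H x| <= r / 8]).
  by apply: filterI => //; exact: continuous_norm_le.
rewrite /interior; apply: filterS nV => y [By /=]; rewrite Hx subr0 => Hy.
have LD h : group_ball G r h -> D (act h y).
  move=> [Gh hr]; apply: (AB (h, y)) => //.
  by split => //; apply: r1A; exact: le_trans rr1.
have LW h : group_ball G r h -> W (act h y) by move=> /LD/DW[].
have [cL _] := Hr0 _ rr0.
have Dy : D y by rewrite -(act_one hact y); exact: LD (group_ball1 hG r_gt0).
have [Wy _] := DW _ Dy.
have [||m [/(_ y)[h Lh mh] /(_ y) mmin _]] := @compact_min_continuous R _ X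
    (group_ball G r) (fun h y => `|H (act h y) - 0|) cL.
- by exists 1%:M; exact: group_ball1.
- move=> g0 y0 e [Gg0 _] e0.
  have [[A' B'] /= nAB' AB'] := act_comp_near hact y0 cN Gg0 e0.
  by exists (A', B') => // -[g z] /= ABz [Gg _]; exact: (AB' (g, z)).
have {}mmin k : group_ball G r k -> `|H (act h y)| <= `|H (act k y)|.
  by move=> /mmin; rewrite mh !subr0.
have [Gh hr] := Lh.
(* Minimality gives [|H(hy)| <= |H(y)| <= r / 8], hence [|h - 1| / 2 <= r / 4]. The minimizer is
   thus interior to the ball, which leaves room for [descent]. *)
have hlt : `|h - 1%:M| < r.
  have := mmin _ (group_ball1 hG r_gt0); rewrite (act_one hact).
  have [_] := hW y h Wy (LW _ Lh) Gh (le_trans hr rrho).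
  by have := ler_normB (H (act h y)) (H y); lra.
have Hhy : H (act h y) = 0.
  apply/eqP; apply: contrapT => /negP Hn0.
  have [k Gk krho khr|k Lk] := @descent R n G X act hG P H rho r y h Pid HT rho0
    Gh hlt Hn0.
    have Lkh : group_ball G r (k *m h) by split => //; exact: mlg_mul.
    have E : act (k *m h) y = act k (act h y) by rewrite (act_mul hact).
    have := hW (act h y) k (LW _ Lh); rewrite -E => /(_ (LW _ Lkh) Gk krho).
    by case.
  by rewrite ltNge mmin.
have uh : h \in unitmx by exact: (mlg_sub hG).
(* The point [y] is [h^-1] applied to the point [h y] of [S], and [|h^-1 - 1| <= 2 c r <= r0] places
   [h^-1] in [K]. *)
exists (invmx h).
  have [_ LK] := Hr0 _ (lexx r0); apply: LK; split; first exact: mlg_inv.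
  have -> : invmx h - 1%:M = - (invmx h *m (h - 1%:M)).
    by rewrite mulmxBr mulVmx// mulmx1 opprB.
  rewrite normrN (le_trans (norm_mulmx _ _))// (le_trans _ rc0)//.
  have ch : c * `|h - 1%:M| <= c * r by rewrite ler_pM2l; lra.
  have hV : `|invmx h| <= 2 by apply: norm_invmx => //; lra.
  have -> : r * (2 * c) = c * 2 * r by ring.
  by apply: ler_pM => //; [rewrite mulr_ge0//; lra|rewrite ler_pM2l; lra].
exists (act h y); first by split => //; exact: LD.
exact: (act_invmx hG hact).
Qed.
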